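(* Let $p>2$ be a prime, $\mathbf{F}$ a field of characteristic $p$ and $\ell\ge 1$. Choose a basis $\{X_i,Y_i,Z_i\mid i=1,\ldots,\ell\}$ of $(\ell V_3)^*$ with $\Delta(Z_i)=Y_i$, $\Delta(Y_i)=X_i$, $\Delta(X_i)=0$. In top degree, $\ell(p-1)+1$, the $\ell$ (non-zero) multidegree components of $\mathbf{F}[\ell V_3]_{\mathbf{Z}/p}$ are one-dimensional, with each component given by $y_jz^{(p-1,p-1,\ldots,p-1)}\mathbf{F}$ (for $j=1,\ldots,\ell$). For total degree greater than zero and less than $\ell(p-1)+1$, each (non-zero) multidegree component is given by the span of $\{z^E,\ y_jz^E/z_j\mid e_j\neq 0\}$, where $E=(e_1,\ldots,e_\ell)$ is the multidegree of the component, and is isomorphic, as an $\mathbf{F}\mathbf{Z}/p$-module, to $V_2\oplus (k-1)V_1$, where $k$ is the number of non-zero entries in $E$.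
   Context: For $n\le p$, $V_n$ is the $n$-dimensional indecomposable representation over $\mathbf{F}$ of the cyclic group $\mathbf{Z}/p=\langle\sigma\rangle$ on which $\sigma$ acts by a single Jordan block with eigenvalue $1$; $\ell V_n$ is the direct sum of $\ell$ copies. For a representation $V$, the action on $V^*$ extends to algebra automorphisms of $\mathbf{F}[V]=S(V^* )$; $\Delta:=\sigma-1$. The Hilbert ideal is the ideal of $\mathbf{F}[V]$ generated by all homogeneous invariants of positive degree, and the ring of coinvariants $\mathbf{F}[V]_{\mathbf{Z}/p}$ is the quotient of $\mathbf{F}[V]$ by it. Lower case letters denote images in the coinvariants of the variables written in upper case; $z^E:=\prod_i z_i^{e_i}$, and $z^E/z_j$ means $z^{E'}$ with $E'$ obtained from $E$ by lowering $e_j$ by one. $\mathbf{F}[\ell V_3]$ is graded over $\mathbf{Z}^{\ell}$ (multidegree) by giving $X_i,Y_i,Z_i$ the multidegree $b_i$, the $i$-th standard basis vector; the Hilbert ideal is homogeneous for this grading and the group preserves it, so the coinvariants inherit a $\mathbf{Z}^\ell$-grading by $\mathbf{F}\mathbf{Z}/p$-submodules. A basis of $\mathbf{F}[\ell V_3]_{\mathbf{Z}/p}$ is given by the elements $y_j^{\varepsilon}z^{A}$ with $1\le j\le\ell$, $\varepsilon\in\{0,1\}$ and $A=(a_1,\ldots,a_\ell)$, $0\le a_i\le p-1$.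
   Formalization: The printed isomorphism type fails when some e_j = p (e.g. ℓ=2, E=(p,0): the component is the line spanned by y_1z_1^{p-1}, not V_2); the formal statement asserts V_2⊕(k-1)V_1 when all e_i<p and V_1 for the remaining non-zero components. *)

(* Defs.v *)
From HB Require Import structures.
From mathcomp Require Import all_boot all_order all_algebra.
From mathcomp Require Import boolp mpoly.

Set Implicit Arguments.
Unset Strict Implicit.
Unset Printing Implicit Defensive.

Import GRing.Theory.
Local Open Scope ring_scope.
Local Open Scope quotient_scope.

Section Generalities.

Definition in_gen_ideal (R : comNzRingType) (S : R -> Prop) (f : R) : Prop :=
  exists (n : nat) (a s : 'I_n -> R),
    (forall i, S (s i)) /\ f = \sum_(i < n) a i * s i.

Definition in_span (F : fieldType) (W : lmodType F) (s : seq W) (x : W) : Prop :=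
  exists c : 'I_(size s) -> F, x = \sum_(i < size s) c i *: s`_i.

(* A representation of Z/p = <sigma> is an F-space together with the action of
   sigma.  [iso_to_sub gU gW W'] : the representation (U, gU) is isomorphic to
   the subrepresentation of (W, gW) carried by the subset W'. *)
Definition iso_to_sub (F : fieldType) (U W : lmodType F)
    (gU : U -> U) (gW : W -> W) (W' : W -> Prop) : Prop :=
  exists f : {linear U -> W},
    [/\ injective f,
        forall x, W' x <-> exists u, f u = x &
        forall u, f (gU u) = gW (f u)].

End Generalities.

Section IndecomposableModules.
Variable F : fieldType.

Definition jordan1 (n : nat) : 'M[F]_n :=
  \matrix_(i, j) ((i == j)%:R + ((i.+1 == j)%N)%:R).

Definition Vrep (n : nat) : lmodType F := 'rV[F]_n.
Definition Vact (n : nat) (v : Vrep n) : Vrep n := v *m jordan1 n.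

Definition V2_plus_V1s (m : nat) : lmodType F :=
  (Vrep 2 * {ffun 'I_m -> Vrep 1})%type.
Definition V2_plus_V1s_act (m : nat) (u : V2_plus_V1s m) : V2_plus_V1s m :=
  (Vact u.1, [ffun i => Vact (u.2 i)]).

End IndecomposableModules.

Section Coinvariants.
Variables (F : fieldType) (l : nat).

(* F[l V_3] = S((l V_3)^* ), with the 3 l variables ordered as
   X_1, ..., X_l, Y_1, ..., Y_l, Z_1, ..., Z_l. *)
Local Notation FV3 := {mpoly F[l + l + l]}.

Definition ix (i : 'I_l) : 'I_(l + l + l) := lshift l (lshift l i).
Definition iy (i : 'I_l) : 'I_(l + l + l) := lshift l (rshift l i).
Definition iz (i : 'I_l) : 'I_(l + l + l) := rshift (l + l) i.

Definition sigma_var (k : 'I_(l + l + l)) : FV3 :=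
  match split k with
  | inl k' => match split k' with
              | inl i => 'X_(ix i)
              | inr i => 'X_(iy i) + 'X_(ix i)
              end
  | inr i => 'X_(iz i) + 'X_(iy i)
  end.

Definition sigma (f : FV3) : FV3 := f \mPo [tuple sigma_var k | k < l + l + l].

Lemma deltaX i : sigma 'X_(ix i) - 'X_(ix i) = 0.
Proof.
rewrite /sigma comp_mpolyXU -tnth_nth tnth_mktuple /sigma_var.
by rewrite /ix !(unsplitK (inl _)) subrr.
Qed.

Lemma deltaY i : sigma 'X_(iy i) - 'X_(iy i) = 'X_(ix i).
Proof.
rewrite /sigma comp_mpolyXU -tnth_nth tnth_mktuple /sigma_var.
by rewrite /iy (unsplitK (inl _)) (unsplitK (inr _)) addrC addKr.
Qed.

Lemma deltaZ i : sigma 'X_(iz i) - 'X_(iz i) = 'X_(iy i).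
Proof.
rewrite /sigma comp_mpolyXU -tnth_nth tnth_mktuple /sigma_var.
by rewrite /iz (unsplitK (inr _)) addrC addKr.
Qed.

(* Invariance under Z/p is invariance under its generator sigma. *)
Definition pos_homog_invariant (f : FV3) : Prop :=
  sigma f = f /\ exists d : nat, (0 < d)%N /\ f \is d.-homog.

Definition hilbert_ideal (f : FV3) : bool :=
  `[< in_gen_ideal pos_homog_invariant f >].

Lemma hilbert_ideal_closed : idealr_closed hilbert_ideal.
Proof.
split=> [||a f g].
- by apply/asboolP; exists 0%N, (fun=> 0), (fun=> 0); split=> [[]|] //; rewrite big_ord0.
- apply/negP => /asboolP [n [a [s [Ss E]]]].
  have : (1 : FV3)@_0%MM = 0.
    rewrite E raddf_sum big1 // => i _ /=.
    rewrite rmorphM /=; have [_ [d [d0 hd]]] := Ss i.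
    by rewrite (dhomog_nemf_coeff hd) ?mulr0 // mf0 eq_sym -lt0n.
  by rewrite mcoeff1 eqxx => /eqP; rewrite oner_eq0.
- move=> /asboolP [n [b [s [Ss ->]]]] /asboolP [m [c [t [St ->]]]].
  apply/asboolP; exists (n + m)%N.
  exists (fun i => match split i with inl j => a * b j | inr j => c j end).
  exists (fun i => match split i with inl j => s j | inr j => t j end).
  split=> [i|]; first by case: (split i).
  rewrite big_split_ord mulr_sumr; congr (_ + _); apply: eq_bigr => i _.
  + by rewrite (unsplitK (inl _)) mulrA.
  + by rewrite (unsplitK (inr _)).
Qed.

HB.instance Definition _ := isIdealr.Build FV3 hilbert_ideal hilbert_ideal_closed.

Definition hilbert_idealr : idealr FV3 := hilbert_ideal.

Definition coinvariants : Type := {ideal_quot hilbert_idealr}.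
HB.instance Definition _ := GRing.ComNzRing.on coinvariants.

Definition coinv_pi (f : FV3) : coinvariants :=
  \pi_({ideal_quot hilbert_idealr}) f.

Fact coinv_pi_is_zmod_morphism : zmod_morphism coinv_pi.
Proof. by move=> f g; rewrite /coinv_pi rmorphB. Qed.
Fact coinv_pi_is_monoid_morphism : monoid_morphism coinv_pi.
Proof. by split=> [|f g]; rewrite /coinv_pi ?rmorph1 ?rmorphM. Qed.
HB.instance Definition _ :=
  GRing.isZmodMorphism.Build FV3 coinvariants coinv_pi coinv_pi_is_zmod_morphism.
HB.instance Definition _ :=
  GRing.isMonoidMorphism.Build FV3 coinvariants coinv_pi
    coinv_pi_is_monoid_morphism.

Lemma coinv_piK (x : coinvariants) : coinv_pi (repr x) = x.
Proof. exact: reprK. Qed.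

Lemma coinv_pi_eq (f g : FV3) :
  coinv_pi f = coinv_pi g <-> in_gen_ideal pos_homog_invariant (f - g).
Proof.
split=> [/eqP|h]; last apply/eqP; rewrite -Quotient.idealrBE; last exact/asboolP.
by move/asboolP.
Qed.

Definition coinv_scale (c : F) (x : coinvariants) : coinvariants :=
  coinv_pi c%:MP * x.

Fact coinv_scaleA a b x : coinv_scale a (coinv_scale b x) = coinv_scale (a * b) x.
Proof. by rewrite /coinv_scale mulrA -rmorphM mpolyCM. Qed.
Fact coinv_scale1 : left_id 1 coinv_scale.
Proof. by move=> x; rewrite /coinv_scale mpolyC1 rmorph1 mul1r. Qed.
Fact coinv_scaleDr : right_distributive coinv_scale +%R.
Proof. by move=> a x y; rewrite /coinv_scale mulrDr. Qed.
Fact coinv_scaleDl x : {morph coinv_scale^~ x : a b / a + b}.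
Proof. by move=> a b; rewrite /coinv_scale mpolyCD rmorphD mulrDl. Qed.
HB.instance Definition _ := GRing.Zmodule_isLmodule.Build F coinvariants
  coinv_scaleA coinv_scale1 coinv_scaleDr coinv_scaleDl.

Definition coinv_sigma (x : coinvariants) : coinvariants :=
  coinv_pi (sigma (repr x)).

Lemma coinv_sigma_pi (f : FV3) : coinv_sigma (coinv_pi f) = coinv_pi (sigma f).
Proof.
apply/coinv_pi_eq.
have /coinv_pi_eq [n [a [s [Ss E]]]] : coinv_pi (repr (coinv_pi f)) = coinv_pi f.
  exact: coinv_piK.
exists n, (fun i => sigma (a i)), s; split=> //.
rewrite /sigma -[LHS]raddfB E raddf_sum /=.
apply: eq_bigr => i _; rewrite rmorphM /=; congr (_ * _).
by case: (Ss i).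
Qed.

(* Multidegrees in Z^l have nonnegative entries for nonzero elements, so they
   are encoded as exponent vectors; [mdeg E] is the total degree of E and
   U_(i) is the basis vector b_i. *)
Definition multideg (m : 'X_{1..l + l + l}) : 'X_{1..l} :=
  [multinom (m (ix i) + m (iy i) + m (iz i))%N | i < l].

Definition multihomog (E : 'X_{1..l}) (f : FV3) : Prop :=
  forall m, m \in msupp f -> multideg m = E.

Definition component (E : 'X_{1..l}) (x : coinvariants) : Prop :=
  exists2 f, multihomog E f & x = coinv_pi f.

Definition component_nonzero (E : 'X_{1..l}) : Prop :=
  exists2 x, component E x & x != 0.

Definition cy (j : 'I_l) : coinvariants := coinv_pi 'X_(iy j).
Definition cz (i : 'I_l) : coinvariants := coinv_pi 'X_(iz i).
Definition zmon (E : 'X_{1..l}) : coinvariants := \prod_(i < l) cz i ^+ E i.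

(* z^E, followed by y_j z^E / z_j for the j with e_j != 0. *)
Definition component_gens (E : 'X_{1..l}) : seq coinvariants :=
  zmon E :: [seq cy j * zmon (E - U_(j))%MM | j <- enum 'I_l & E j != 0%N].

Definition nb_nonzero (E : 'X_{1..l}) : nat := #|[set i : 'I_l | E i != 0%N]|.

Definition const_multideg (a : nat) : 'X_{1..l} := [multinom a | i < l].

End Coinvariants.

(* Main.v *)
(** The Hilbert ideal is the monomial ideal generated by the X_i, the Y_i Y_j
    and the Z_i^p.  It contains them: X_i and
    Y_i Y_j - X_i Z_j - Z_i X_j - X_i Y_j are invariant, and the norm
    \prod_(k < p) (Z_i + k Y_i + C(k,2) X_i) of Z_i is congruent to Z_i^p modulo
    X_i and Y_i^2.  Conversely, differentiating sigma f = f and then putting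
    X = Y = 0 shows that df/dY_j and df/dZ_j vanish there for every invariant f,
    so f has no monomial Y_j Z^A, and no monomial Z^A with some a_j nonzero
    mod p.  Hence the remaining ("standard") monomials form a basis of the
    coinvariants, on which sigma fixes y_j z^A and sends z^E to
    z^E + \sum_j e_j y_j z^E / z_j. *)
Require Import Defs.
From HB Require Import structures.
From mathcomp Require Import all_boot all_order all_algebra.
From mathcomp Require Import boolp mpoly ring.
Import GRing.Theory.
Local Open Scope ring_scope.

Section HilbertIdeal.

Set Implicit Arguments.
Unset Strict Implicit.
Unset Printing Implicit Defensive.

(** * Derivations of a polynomial ring along a map to another ring *)

Definition derivation_along (n : nat) (R S : comNzRingType)
    (r d : {mpoly R[n]} -> S) : Prop :=
  [/\ forall f g, d (f + g) = d f + d g,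
      forall f g, d (f * g) = d f * r g + r f * d g &
      forall c, d c%:MP = 0].

(** The Leibniz rule carries vanishing from the variables to all monomials, and additivity to all
    polynomials. *)
Lemma derivation_along_eq0 (n : nat) (R S : comNzRingType)
    (r d : {mpoly R[n]} -> S) :
  derivation_along r d -> (forall i, d 'X_i = 0) -> forall f, d f = 0.
Proof.
case=> dD dM dC dX; elim/mpolyind => [|c m f _ _ IH]; first by rewrite -mpolyC0 dC.
rewrite dD IH addr0 -mul_mpolyC dM dC mul0r add0r mpolyXE_id.
suff -> : d (\prod_(i < n) 'X_i ^+ m i) = 0 by rewrite mulr0.
elim/big_ind: _ => [|f1 f2 df1 df2|i _].
- by rewrite -mpolyC1 dC.
- by rewrite dM df1 df2 mul0r mulr0 addr0.
- elim: (m i) => [|k IHk]; first by rewrite expr0 -mpolyC1 dC.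
  by rewrite exprS dM IHk dX mul0r mulr0 addr0.
Qed.

(** The difference of the two sides is again a derivation along [r], and it kills the variables.
    This turns the chain rules below into checks on variables. *)
Lemma derivation_along_eqD (n : nat) (R S : comNzRingType)
    (r d1 d2 d3 : {mpoly R[n]} -> S) :
  derivation_along r d1 -> derivation_along r d2 -> derivation_along r d3 ->
  (forall i, d1 'X_i = d2 'X_i + d3 'X_i) -> forall f, d1 f = d2 f + d3 f.
Proof.
move=> [D1 M1 C1] [D2 M2 C2] [D3 M3 C3] dX f; apply/eqP; rewrite -subr_eq0; apply/eqP.
move: f; apply: (@derivation_along_eq0 _ _ _ r) => [|i]; last by rewrite dX subrr.
split=> [f g|f g|c]; first by rewrite D1 D2 D3; ring.
- by rewrite M1 M2 M3; ring.
- by rewrite C1 C2 C3 addr0 subrr.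
Qed.

(** * The three families of variables and the action of [sigma] on them *)

Variables (F : fieldType) (l : nat).
Local Notation FV3 := {mpoly F[l + l + l]}.
Local Notation x_ := (@ix l).
Local Notation y_ := (@iy l).
Local Notation z_ := (@iz l).

HB.instance Definition _ := GRing.LRMorphism.copy (@sigma F l)
  (comp_mpoly [tuple sigma_var F k | k < l + l + l]).

Variant idx_spec : 'I_(l + l + l) -> Type :=
  | IdxX i : idx_spec (x_ i)
  | IdxY i : idx_spec (y_ i)
  | IdxZ i : idx_spec (z_ i).

Lemma idxP k : idx_spec k.
Proof.
rewrite -(splitK k); case: (split k) => [k'|i] /=; last exact: IdxZ.
by rewrite -(splitK k'); case: (split k') => i /=; [exact: IdxX | exact: IdxY].
Qed.

Lemma eq_idx :
  ((forall i j, (x_ i == x_ j) = (i == j)) * (forall i j, (x_ i == y_ j) = false)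
  * (forall i j, (x_ i == z_ j) = false) * (forall i j, (y_ i == x_ j) = false)
  * (forall i j, (y_ i == y_ j) = (i == j)) * (forall i j, (y_ i == z_ j) = false)
  * (forall i j, (z_ i == x_ j) = false) * (forall i j, (z_ i == y_ j) = false)
  * (forall i j, (z_ i == z_ j) = (i == j)))%type.
Proof.
rewrite /ix /iy /iz; do 8?split; move=> i j.
all: by rewrite ?(eq_lshift, eq_rshift, eq_lrshift, eq_rlshift).
Qed.

Lemma sigmaD (f g : FV3) : sigma (f + g) = sigma f + sigma g.
Proof. exact: raddfD. Qed.

Lemma sigmaB (f g : FV3) : sigma (f - g) = sigma f - sigma g.
Proof. exact: raddfB. Qed.

Lemma sigmaM (f g : FV3) : sigma (f * g) = sigma f * sigma g.
Proof. exact: rmorphM. Qed.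

Lemma sigmaC c : sigma (c%:MP : FV3) = c%:MP.
Proof. exact: comp_mpolyC. Qed.

Lemma sigmaX i : sigma ('X_(x_ i) : FV3) = 'X_(x_ i).
Proof. by apply/eqP; rewrite -subr_eq0 deltaX. Qed.

Lemma sigmaY i : sigma ('X_(y_ i) : FV3) = 'X_(y_ i) + 'X_(x_ i).
Proof. by rewrite -deltaY addrC subrK. Qed.

Lemma sigmaZ i : sigma ('X_(z_ i) : FV3) = 'X_(z_ i) + 'X_(y_ i).
Proof. by rewrite -deltaZ addrC subrK. Qed.

(** * Setting X = Y = 0, and the derivatives of invariants *)

Definition is_z_idx (k : 'I_(l + l + l)) : bool := (l + l <= k)%N.

Lemma is_z_idxE : ((forall i, is_z_idx (x_ i) = false) *
  (forall i, is_z_idx (y_ i) = false) * (forall i, is_z_idx (z_ i) = true))%type.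
Proof.
rewrite /is_z_idx; do 2?split; move=> i /=; rewrite ?leq_addr //.
- by rewrite leqNgt (leq_trans (ltn_ord i)) ?leq_addr.
- by rewrite leq_add2l leqNgt ltn_ord.
Qed.

(** The substitution X = Y = 0, kept as an endomorphism of the full ring so that it can be composed
    with [sigma] and with partial derivatives. *)
Definition restrict_z (f : FV3) : FV3 :=
  f \mPo [tuple if is_z_idx k then 'X_k else 0 | k < l + l + l].

HB.instance Definition _ := GRing.LRMorphism.copy restrict_z
  (comp_mpoly [tuple if is_z_idx k then 'X_k else 0 | k < l + l + l]).

Lemma restrict_zD f g : restrict_z (f + g) = restrict_z f + restrict_z g.
Proof. exact: raddfD. Qed.

Lemma restrict_zM f g : restrict_z (f * g) = restrict_z f * restrict_z g.
Proof. exact: rmorphM. Qed.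

Lemma restrict_z0 : restrict_z 0 = 0.
Proof. exact: raddf0. Qed.

Lemma restrict_zU k : restrict_z 'X_k = if is_z_idx k then 'X_k else 0.
Proof. by rewrite /restrict_z comp_mpolyXU -tnth_nth tnth_mktuple. Qed.

(** A monomial involving some X or Y is sent to 0, and a monomial in the Z alone is fixed. *)
Lemma mcoeff_restrict_z f (m : 'X_{1..l + l + l}) : (forall k, ~~ is_z_idx k -> m k = 0%N) ->
  (restrict_z f)@_m = f@_m.
Proof.
move=> mz; elim/mpolyind: f => [|c m' f _ _ IH]; first by rewrite raddf0.
rewrite raddfD /= linearZ /= !mcoeffD !mcoeffZ {}IH; congr (_ * _ + _).
have [/existsP [k /andP [kz mk]]|] := boolP [exists k, ~~ is_z_idx k && (m' k != 0%N)].
  suff -> : restrict_z 'X_[m'] = 0.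
    rewrite mcoeff0 mcoeffX; case: eqP => // E.
    by move: mk; rewrite E mz.
  rewrite /restrict_z comp_mpolyX (bigD1 k) //= tnth_mktuple (negPf kz).
  by rewrite expr0n (negPf mk) mul0r.
rewrite negb_exists => /forallP m'z; congr (_@_ _).
rewrite /restrict_z comp_mpolyX mpolyXE_id; apply: eq_bigr => k _.
rewrite tnth_mktuple; case: ifP => // kz; move: (m'z k).
by rewrite kz negb_and /= negbK => /eqP ->; rewrite !expr0.
Qed.

(** [sigma] changes each variable by 0, an X or a Y, all of which the substitution kills. *)
Lemma restrict_sigma (f : FV3) : restrict_z (sigma f) = restrict_z f.
Proof.
elim/mpolyind: f => [|c m f _ _ IH]; first by rewrite [sigma 0]raddf0.
rewrite sigmaD !restrict_zD IH -mul_mpolyC sigmaM !restrict_zM.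
rewrite sigmaC mpolyXE_id.
set g := \prod_(k < _) _; have -> // : restrict_z (sigma g) = restrict_z g.
rewrite {}/g; elim/big_ind: _ => [|f1 f2 df1 df2|k _]; first by rewrite [sigma 1]rmorph1.
  by rewrite sigmaM !restrict_zM df1 df2.
elim: (m k) => [|n IHn]; first by rewrite expr0 [sigma 1]rmorph1.
rewrite exprS sigmaM !restrict_zM {}IHn; congr (_ * _).
case: (idxP k) => i; rewrite ?sigmaX ?sigmaY ?sigmaZ ?restrict_zD !restrict_zU !is_z_idxE //.
  exact: addr0.
exact: addr0.
Qed.

Lemma mderivXU (i j : 'I_(l + l + l)) : ('X_j : FV3)^`M(i) = (j == i)%:R.
Proof.
rewrite mderivX mnm1E; case: eqP => [->|]; last by rewrite scale0r.
rewrite scale1r; apply/mpolyP => m; rewrite mcoeffX mcoeff1.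
by rewrite eq_sym; congr (_ == _)%:R; apply/mnmP => k; rewrite mnmBE subnn mnm0E.
Qed.

Lemma derivation_restrict_mderiv k :
  derivation_along restrict_z (fun f => restrict_z f^`M(k)).
Proof.
split=> [f g|f g|c]; first by rewrite mderivD restrict_zD.
- by rewrite mderivM restrict_zD !restrict_zM.
- by rewrite mderivC restrict_z0.
Qed.

(** The Leibniz rule would naturally involve [restrict_z] after [sigma]; by [restrict_sigma] this is
    [restrict_z] itself, so the composite is comparable with plain partial derivatives. *)
Lemma derivation_restrict_mderiv_sigma k :
  derivation_along restrict_z (fun f => restrict_z (sigma f)^`M(k)).
Proof.
split=> [f g|f g|c]; first by rewrite sigmaD mderivD restrict_zD.
- by rewrite sigmaM mderivM restrict_zD !restrict_zM !restrict_sigma.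
- by rewrite sigmaC mderivC restrict_z0.
Qed.

(** Both sides are derivations along [restrict_z], and [Y_j] occurs exactly in the images of [Y_j]
    and [Z_j], with coefficient 1. *)
Lemma chain_ruleY j (f : FV3) :
  restrict_z (sigma f)^`M(y_ j) = restrict_z f^`M(y_ j) + restrict_z f^`M(z_ j).
Proof.
move: f; apply: derivation_along_eqD (derivation_restrict_mderiv_sigma _)
  (derivation_restrict_mderiv _) (derivation_restrict_mderiv _) _ => k.
case: (idxP k) => i; rewrite ?sigmaX ?sigmaY ?sigmaZ ?mderivD !mderivXU !eq_idx.
all: by rewrite /= ?mulr0n ?addr0 ?add0r ?restrict_z0 ?add0r ?addr0.
Qed.

Lemma chain_ruleX j (f : FV3) :
  restrict_z (sigma f)^`M(x_ j) = restrict_z f^`M(x_ j) + restrict_z f^`M(y_ j).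
Proof.
move: f; apply: derivation_along_eqD (derivation_restrict_mderiv_sigma _)
  (derivation_restrict_mderiv _) (derivation_restrict_mderiv _) _ => k.
case: (idxP k) => i; rewrite ?sigmaX ?sigmaY ?sigmaZ ?mderivD !mderivXU !eq_idx.
all: by rewrite /= ?mulr0n ?addr0 ?add0r ?restrict_z0 ?add0r ?addr0.
Qed.

(** When [sigma f = f], the first term on the right of each chain rule cancels the left side: the X
    rule leaves the Y-derivative, the Y rule leaves the Z-derivative. *)
Lemma sigma_fixed_mderiv j (f : FV3) : sigma f = f ->
  restrict_z f^`M(y_ j) = 0 /\ restrict_z f^`M(z_ j) = 0.
Proof.
move=> sf; split.
- by move/eqP: (chain_ruleX j f); rewrite sf -subr_eq0 opprD addNKr oppr_eq0 => /eqP.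
- by move/eqP: (chain_ruleY j f); rewrite sf -subr_eq0 opprD addNKr oppr_eq0 => /eqP.
Qed.

(** * Relations in the coinvariants: the X and the products of two Y *)

Lemma coinv_piD (f g : FV3) : coinv_pi (f + g) = coinv_pi f + coinv_pi g.
Proof. exact: raddfD. Qed.

Lemma coinv_piB (f g : FV3) : coinv_pi (f - g) = coinv_pi f - coinv_pi g.
Proof. exact: raddfB. Qed.

Lemma coinv_piM (f g : FV3) : coinv_pi (f * g) = coinv_pi f * coinv_pi g.
Proof. exact: rmorphM. Qed.

Lemma coinv_piZ c (f : FV3) : coinv_pi (c *: f) = c *: coinv_pi f.
Proof. by rewrite -mul_mpolyC coinv_piM. Qed.

Lemma coinv_pi0 : coinv_pi (0 : FV3) = 0.
Proof. exact: raddf0. Qed.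

Lemma coinv_pi_ideal (f : FV3) : pos_homog_invariant f -> coinv_pi f = 0.
Proof.
move=> If; rewrite -coinv_pi0; apply/coinv_pi_eq.
by exists 1%N, (fun=> 1), (fun=> f); rewrite big_ord1 mul1r subr0.
Qed.

Lemma coinv_X i : coinv_pi ('X_(x_ i) : FV3) = 0.
Proof.
apply: coinv_pi_ideal; split; first exact: sigmaX.
by exists 1%N; split; rewrite // dhomogX /= mdeg1.
Qed.

Lemma cyM (i j : 'I_l) : cy F i * cy F j = 0.
Proof.
pose f : FV3 := 'X_(y_ i) * 'X_(y_ j) - 'X_(x_ i) * 'X_(z_ j)
  - 'X_(z_ i) * 'X_(x_ j) - 'X_(x_ i) * 'X_(y_ j).
have <- : coinv_pi f = cy F i * cy F j.
  by rewrite /f !coinv_piB !coinv_piM !coinv_X !(mul0r, mulr0, subr0).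
apply: coinv_pi_ideal; split.
  (* Invariance is a polynomial identity, stated over an abstract ring so that [ring] sees only
     variables. *)
  have E (R : comNzRingType) (x x' y y' z z' : R) :
      (y + x) * (y' + x') - x * (z' + y') - (z + y) * x' - x * (y' + x') =
      y * y' - x * z' - z * x' - x * y' by ring.
  by rewrite /f !sigmaB !sigmaM !(sigmaX, sigmaY, sigmaZ) E.
have h k k' : ('X_k * 'X_k' : FV3) \is 2.-homog.
  by rewrite (dhomogM (d := 1) (e := 1)) ?dhomogX /= ?mdeg1.
by exists 2; split; rewrite // !rpredB.
Qed.

(** * The norm of Z and the relation killing its p-th power *)

Variable p : nat.
Hypotheses (p_char : p \in [pchar F]) (p_gt2 : (2 < p)%N).

(** This is [Z_i] after k applications of [sigma]; the norm is the product over k < p. *)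
Definition norm_factor i k : FV3 :=
  'X_(z_ i) + k%:R *: 'X_(y_ i) + 'C(k, 2)%:R *: 'X_(x_ i).

(** Here p > 2 matters: for p = 2 the binomial coefficient is 1. *)
Lemma bin2_pchar : 'C(p, 2)%:R = 0 :> F.
Proof.
apply/eqP; rewrite -(dvdn_pcharf p_char).
by apply: prime_dvd_bin; rewrite ?(pcharf_prime p_char).
Qed.

Lemma sigma_norm_factor i k : sigma (norm_factor i k) = norm_factor i k.+1.
Proof.
rewrite /norm_factor -!mul_mpolyC !sigmaD !sigmaM !sigmaC sigmaX sigmaY sigmaZ.
rewrite binS bin1 -[k.+1]addn1 !natrD mulr1n !mpolyCD mpolyC1.
have E (R : comNzRingType) (x y z a b : R) :
  z + y + a * (y + x) + b * x = z + (a + 1) * y + (b + a) * x by ring.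
by rewrite E.
Qed.

Lemma norm_factor_p i : norm_factor i p = norm_factor i 0.
Proof. by rewrite /norm_factor bin2_pchar bin0n (pcharf0 p_char). Qed.

(** In the coinvariants the norm becomes the product of the z + k y for k < p. As y^2 = 0, this is
    z^p + C(p,2) y z^(p-1), and C(p,2) vanishes in F. *)
Lemma cz_p (i : 'I_l) : cz F i ^+ p = 0.
Proof.
have p_gt0 : (0 < p)%N by apply: leq_trans p_gt2.
have nfE k : coinv_pi (norm_factor i k) = cz F i + k%:R * cy F i.
  rewrite /norm_factor !coinv_piD !coinv_piZ coinv_X scaler0 addr0.
  by rewrite scaler_nat mulr_natl.
have step (R : comNzRingType) (y z c : R) n : y * y = 0 ->
    (z ^+ n.+1 + c * y * z ^+ n) * (z + n.+1%:R * y) =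
    z ^+ n.+2 + (c + n.+1%:R) * y * z ^+ n.+1.
  move=> y2; rewrite [z ^+ n.+2]exprS exprS.
  transitivity (z * (z * z ^+ n) + (c + n.+1%:R) * y * (z * z ^+ n)
     + c * n.+1%:R * z ^+ n * (y * y)); first by ring.
  by rewrite y2 mulr0 addr0.
have piE n : coinv_pi (\prod_(0 <= k < n.+1) norm_factor i k) =
    cz F i ^+ n.+1 + 'C(n.+1, 2)%:R * cy F i * cz F i ^+ n.
  elim: n => [|n IH].
    by rewrite big_nat1 nfE bin_small // !mul0r.
  rewrite big_nat_recr //= coinv_piM IH nfE step ?cyM //.
  by rewrite [in RHS]binS bin1 [in RHS]natrD.
have zpE : coinv_pi (\prod_(0 <= k < p) norm_factor i k) = cz F i ^+ p.
  rewrite -(prednK p_gt0) piE prednK // mulr_natl -scaler_nat bin2_pchar.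
  by rewrite scale0r mul0r addr0.
rewrite -zpE; apply: coinv_pi_ideal; split.
  (* [sigma] permutes the factors cyclically, since the factor of index p equals the one of index
     0. *)
  rewrite rmorph_prod /=; under eq_bigr do rewrite sigma_norm_factor.
  rewrite -(prednK p_gt0) big_nat_recr // [RHS]big_nat_recl //=.
  by rewrite prednK // norm_factor_p mulrC.
exists p; split=> //; elim: p => [|n IH]; first by rewrite big_geq // dhomog1.
rewrite big_nat_recr //= -addn1; apply: dhomogM IH _.
by rewrite !rpredD // ?rpredZ // dhomogX /= mdeg1.
Qed.

(** * Standard monomials as a basis of the coinvariants *)

Definition zmnm (A : 'X_{1..l}) : 'X_{1..l + l + l} :=
  [multinom match split k with inr i => A i | inl _ => 0%N end | k < l + l + l].

Lemma zmnmE A : ((forall i, zmnm A (x_ i) = 0%N) *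
  (forall i, zmnm A (y_ i) = 0%N) * (forall i, zmnm A (z_ i) = A i))%type.
Proof.
do 2?split; move=> i; rewrite mnmE /ix /iy /iz.
- by rewrite (unsplitK (inl _)).
- by rewrite (unsplitK (inl _)).
- by rewrite (unsplitK (inr _)).
Qed.

(** The monomials divisible by no [X_i], [Y_i Y_j] or [Z_i^p]. Bounding the total Y-degree by 1
    excludes the squares of the [Y_i] as well. *)
Definition standard (m : 'X_{1..l + l + l}) : bool :=
  [&& [forall i, m (x_ i) == 0%N], (\sum_(i < l) m (y_ i) <= 1)%N
    & [forall i, (m (z_ i) < p)%N]].

Lemma standardDl (m1 m2 : 'X_{1..l + l + l}) :
  standard (m1 + m2)%MM -> standard m2.
Proof.
case/and3P => /forallP mx my /forallP mz; apply/and3P; split.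
- by apply/forallP => i; move: (mx i); rewrite mnmDE addn_eq0 => /andP [].
- apply: leq_trans my; apply: leq_sum => i _.
  by rewrite mnmDE leq_addl.
- apply/forallP => i; apply: leq_ltn_trans (mz i).
  by rewrite mnmDE leq_addl.
Qed.

Lemma standard_zmnm (A : 'X_{1..l}) : standard (zmnm A) = [forall i, (A i < p)%N].
Proof.
rewrite /standard big1 ?leq0n /= => [|i _]; last by rewrite zmnmE.
have -> : [forall i, zmnm A (x_ i) == 0%N] by apply/forallP => i; rewrite zmnmE.
by apply: eq_forallb => i; rewrite zmnmE.
Qed.

Lemma standard_yzmnm j (A : 'X_{1..l}) :
  standard (zmnm A + U_(y_ j))%MM = [forall i, (A i < p)%N].
Proof.
rewrite /standard (bigD1 j) //= big1 ?addn0 => [|i ij]; last first.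
  by rewrite mnmDE mnm1E zmnmE !eq_idx eq_sym (negPf ij).
rewrite mnmDE mnm1E zmnmE eqxx /=.
have -> : [forall i, (zmnm A + U_(y_ j))%MM (x_ i) == 0%N].
  by apply/forallP => i; rewrite mnmDE mnm1E zmnmE !eq_idx.
by apply: eq_forallb => i; rewrite mnmDE mnm1E zmnmE !eq_idx addn0.
Qed.

Variant standard_spec : 'X_{1..l + l + l} -> Prop :=
  | StandardZ (A : 'X_{1..l}) of [forall i, (A i < p)%N] : standard_spec (zmnm A)
  | StandardYZ (j : 'I_l) (A : 'X_{1..l}) of [forall i, (A i < p)%N] : standard_spec (zmnm A + U_(y_ j))%MM.

Lemma mnm_idxP (m1 m2 : 'X_{1..l + l + l}) :
  (forall i, m1 (x_ i) = m2 (x_ i)) -> (forall i, m1 (y_ i) = m2 (y_ i)) ->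
  (forall i, m1 (z_ i) = m2 (z_ i)) -> m1 = m2.
Proof. by move=> mx my mz; apply/mnmP => k; case: (idxP k). Qed.

Lemma standardP m : standard m -> standard_spec m.
Proof.
case/and3P => /forallP mx my mz; pose A := [multinom m (z_ i) | i < l].
have Ap : [forall i, (A i < p)%N].
  by apply/forallP => i; rewrite mnmE (forallP mz).
have [/existsP [j mj]|m0] := boolP [exists j, m (y_ j) != 0%N]; last first.
  suff -> : m = zmnm A by left.
  apply: mnm_idxP => i; rewrite zmnmE ?mnmE //; first exact/eqP.
  by apply/eqP; apply: contraR m0 => mi; apply/existsP; exists i.
suff -> : m = (zmnm A + U_(y_ j))%MM by right.
apply: mnm_idxP => i; rewrite mnmDE mnm1E zmnmE !eq_idx ?addn0 ?mnmE //.
  exact/eqP.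
(* Total Y-degree at most 1 forces exponent 1 at j and 0 at every other index. *)
move: my mj; rewrite (bigD1 j) //=; case mj: (m (y_ j)) => [|[|n]] //.
rewrite ltnS leqn0 sum_nat_eq0 => /forallP /(_ i) /implyP mi _.
have [<-|ij] := eqVneq j i; first by rewrite mj.
by rewrite (eqP (mi _)) // eq_sym.
Qed.

Lemma mpolyX_dvd (m : 'X_{1..l + l + l}) (k : 'I_(l + l + l)) : m k != 0%N ->
  'X_[m] = 'X_[m - U_(k)] * 'X_k :> FV3.
Proof. by move=> mk; rewrite -mpolyXD submK // lep1mP. Qed.

(** Each way of failing to be standard exhibits a divisor [X_i], [Y_j Y_j'] or [Z_i^p], and all of
    these vanish in the quotient. *)
Lemma coinv_nonstandard m : ~~ standard m -> coinv_pi ('X_[m] : FV3) = 0.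
Proof.
rewrite !negb_and => /or3P [].
- rewrite negb_forall => /existsP [i mi].
  by rewrite (mpolyX_dvd mi) coinv_piM coinv_X mulr0.
- rewrite -ltnNge => my.
  have [j mj] : exists j, m (y_ j) != 0%N.
    apply/existsP; apply: contraLR my; rewrite negb_exists => /forallP my.
    by rewrite big1 // => i _; apply/eqP; move: (my i); rewrite negbK.
  (* The second Y is sought after removing the first, which also covers the square of [Y_j]. *)
  have [j' mj'] : exists j', (m - U_(y_ j))%MM (y_ j') != 0%N.
    apply/existsP; apply: contraLR my; rewrite negb_exists => /forallP my.
    rewrite -leqNgt (bigD1 j) //= big1 ?addn0.
      by move: (my j); rewrite mnmBE mnm1E eqxx negbK subn_eq0.
    move=> i ij; move: (my i); rewrite mnmBE mnm1E eq_idx [j == i]eq_sym (negPf ij).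
    by rewrite subn0 negbK => /eqP.
  by rewrite (mpolyX_dvd mj) (mpolyX_dvd mj') !coinv_piM -mulrA cyM mulr0.
- rewrite negb_forall => /existsP [i]; rewrite -leqNgt => mi.
  have -> : 'X_[m] = 'X_[m - U_(z_ i) *+ p] * 'X_(z_ i) ^+ p :> FV3.
    rewrite mpolyXn -mpolyXD submK //; apply/mnm_lepP => k.
    by rewrite mulmnE mnm1E; case: eqP => [<-|_]; rewrite ?mul1n ?mul0n.
  by rewrite coinv_piM [coinv_pi (_ ^+ _)]rmorphXn /= cz_p mulr0.
Qed.

(** Up to an invertible factor, the coefficient at a nonconstant standard monomial is a coefficient
    of a restricted Y- or Z-derivative, which is zero. The constant monomial is excluded by the
    positive degree. *)
Lemma mcoeff_pos_homog_invariant (s : FV3) m :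
  pos_homog_invariant s -> standard m -> s@_m = 0.
Proof.
case=> sI [d [d_gt0 dh]].
have rz A k : k \in [pred k | ~~ is_z_idx k] -> zmnm A k = 0%N.
  by rewrite inE; case: (idxP k) => i; rewrite is_z_idxE ?zmnmE.
case/standardP => [A /forallP Ap|j A _].
  have [/eqP A0|] := boolP (A == 0%MM).
    apply: dhomog_nemf_coeff dh _; rewrite /= mdegE big1 ?neq_ltn ?d_gt0 // => k _.
    by case: (idxP k) => i; rewrite zmnmE ?A0 ?mnm0E.
  rewrite -mdeg_eq0 mdegE sum_nat_eq0 negb_forall => /existsP [i /= Ai].
  (* The coefficient of [Z^A / Z_i] in the [Z_i]-derivative is a_i times that of [Z^A], and a_i is
     nonzero in F because 0 < a_i < p. *)
  have [_ /mpolyP /(_ (zmnm (A - U_(i))))] := sigma_fixed_mderiv i sI.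
  rewrite mcoeff0 mcoeff_restrict_z; last exact: rz.
  rewrite mcoeff_deriv zmnmE.
  have -> : (zmnm (A - U_(i)) + U_(z_ i))%MM = zmnm A.
    apply: mnm_idxP => k; rewrite mnmDE mnm1E !zmnmE !eq_idx // mnmBE mnm1E.
    by case: eqP => [<-|_]; rewrite ?subn0 ?addn0 // subnK // lt0n.
  rewrite mnmBE mnm1E eqxx subn1 prednK ?lt0n // => /eqP; rewrite -mulr_natr.
  rewrite mulf_eq0 -(dvdn_pcharf p_char) gtnNdvd ?lt0n ?Ap // orbF => /eqP //.
(* [Y_j] occurs to the first power, so differentiation brings out the factor 1. *)
have [/mpolyP /(_ (zmnm A)) + _] := sigma_fixed_mderiv j sI.
rewrite mcoeff0 mcoeff_restrict_z; last exact: rz.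
by rewrite mcoeff_deriv zmnmE.
Qed.

(** In a multiple of an invariant s, a term of s contributing to a standard monomial divides it,
    hence is standard, and s has no such term. Conversely, nonstandard monomials are zero in the
    quotient. *)
Lemma coinv_pi_eq0 (f : FV3) :
  coinv_pi f = 0 <-> (forall m, standard m -> f@_m = 0).
Proof.
rewrite -coinv_pi0 coinv_pi_eq subr0; split=> [[n [a [s [Is ->]]]]|].
  move=> m sm; rewrite [LHS]raddf_sum big1 // => i _ /=; rewrite mcoeffM big1 // => k.
  move=> /eqP mE; rewrite (mcoeff_pos_homog_invariant (Is i)) ?mulr0 //.
  by apply: (@standardDl k.1); rewrite -mE.
move=> f0; rewrite -[f]subr0; apply/coinv_pi_eq; rewrite coinv_pi0.
rewrite [f]mpolyE [LHS]raddf_sum big1 // => m _ /=.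
have [sm|sm] := boolP (standard m); first by rewrite f0 // scale0r coinv_pi0.
by rewrite coinv_piZ coinv_nonstandard ?scaler0.
Qed.

(** * Multidegree components in coordinates *)

Lemma multideg_zmnm (A : 'X_{1..l}) : multideg (zmnm A) = A.
Proof. by apply/mnmP => i; rewrite mnmE !zmnmE. Qed.

Lemma multideg_yzmnm j (A : 'X_{1..l}) :
  multideg (zmnm A + U_(y_ j))%MM = (A + U_(j))%MM.
Proof.
apply/mnmP => i; rewrite mnmE !mnmDE !zmnmE !mnm1E !eq_idx.
by rewrite !addn0 !add0n addnC.
Qed.

Lemma coinv_zmnm (A : 'X_{1..l}) : coinv_pi 'X_[zmnm A] = zmon F A.
Proof.
rewrite mpolyXE_id !big_split_ord /=.
rewrite [X in X * _ * _]big1 => [|i _]; last by rewrite -/(x_ i) zmnmE expr0.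
rewrite [X in _ * X * _]big1 => [|i _]; last by rewrite -/(y_ i) zmnmE expr0.
rewrite !mul1r [LHS]rmorph_prod; apply: eq_bigr => i _ /=.
by rewrite -/(z_ i) zmnmE [LHS]rmorphXn.
Qed.

Lemma coinv_yzmnm j (A : 'X_{1..l}) :
  coinv_pi 'X_[zmnm A + U_(y_ j)] = cy F j * zmon F A.
Proof. by rewrite mpolyXD coinv_piM coinv_zmnm mulrC. Qed.

Lemma zmonD (A B : 'X_{1..l}) : zmon F (A + B)%MM = zmon F A * zmon F B.
Proof.
by rewrite /zmon -big_split; apply: eq_bigr => i _; rewrite mnmDE exprD.
Qed.

Lemma zmonU (i : 'I_l) : zmon F U_(i)%MM = cz F i.
Proof.
rewrite /zmon (bigD1 i) //= big1 ?mulr1 => [|j ij].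
  by rewrite mnm1E eqxx expr1.
by rewrite mnm1E eq_sym (negPf ij) expr0.
Qed.

(** A polynomial lift of the general combination of z^E and the y_j z^E / z_j, so that its
    coefficients can be read off with [mcoeff]. *)
Definition comb (E : 'X_{1..l}) (c : F) (d : 'I_l -> F) : FV3 :=
  c *: 'X_[zmnm E] +
  \sum_(j | E j != 0%N) d j *: 'X_[zmnm (E - U_(j)) + U_(y_ j)].

Lemma coinv_comb (E : 'X_{1..l}) c d : coinv_pi (comb E c d) =
  c *: zmon F E + \sum_(j | E j != 0%N) d j *: (cy F j * zmon F (E - U_(j))%MM).
Proof.
rewrite coinv_piD coinv_piZ coinv_zmnm [coinv_pi (\sum_(_ | _) _)]raddf_sum.
by congr (_ + _); apply: eq_bigr => j _; rewrite /= coinv_piZ coinv_yzmnm.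
Qed.

Lemma yzmnm_neq (A B : 'X_{1..l}) j : (zmnm A == zmnm B + U_(y_ j))%MM = false.
Proof.
by apply/eqP => /mnmP /(_ (y_ j)); rewrite mnmDE mnm1E !zmnmE eqxx.
Qed.

Lemma mcoeff_comb_z (E : 'X_{1..l}) c d : (comb E c d)@_(zmnm E) = c.
Proof.
rewrite mcoeffD mcoeffZ mcoeffX eqxx mulr1 [X in _ + X]raddf_sum big1 ?addr0 // => j _.
by rewrite /= mcoeffZ mcoeffX eq_sym yzmnm_neq mulr0.
Qed.

Lemma mcoeff_comb_y (E : 'X_{1..l}) c d j : E j != 0%N ->
  (comb E c d)@_(zmnm (E - U_(j)) + U_(y_ j)) = d j.
Proof.
move=> Ej; rewrite mcoeffD mcoeffZ mcoeffX yzmnm_neq mulr0 add0r.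
rewrite [LHS]raddf_sum (bigD1 j) //= big1 ?addr0 => [|i /andP [_ ij]].
  by rewrite mcoeffZ mcoeffX eqxx mulr1.
rewrite mcoeffZ mcoeffX; case: eqP => [/mnmP /(_ (y_ j))|_]; last by rewrite mulr0.
by rewrite !mnmDE !mnm1E !zmnmE !eq_idx eqxx (negPf ij).
Qed.

Lemma multihomog_comb (E : 'X_{1..l}) c d : multihomog E (comb E c d).
Proof.
move=> m; apply: contraTeq => mE; rewrite -mcoeff_eq0 mcoeffD mcoeffZ mcoeffX.
case: (zmnm E =P m) => [E1|_]; first by move: mE; rewrite -E1 multideg_zmnm eqxx.
rewrite mulr0 add0r [X in X == 0]raddf_sum big1 // => j Ej /=; rewrite mcoeffZ mcoeffX.
case: (_ =P m) => [E1|_]; last by rewrite mulr0.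
by move: mE; rewrite -E1 multideg_yzmnm submK ?eqxx // lep1mP.
Qed.

(** The only standard monomials that can have multidegree E are [Z^E] and the [Y_j Z^E / Z_j].
    Taking the coefficients of f at these gives a [comb] that agrees with f at every standard
    monomial. *)
Lemma componentP (E : 'X_{1..l}) (x : coinvariants F l) :
  component E x <-> exists c d, x = coinv_pi (comb E c d).
Proof.
split=> [[f fE ->]|[c [d ->]]]; last by exists (comb E c d) => //; exact: multihomog_comb.
exists f@_(zmnm E), (fun j => f@_(zmnm (E - U_(j)) + U_(y_ j))).
apply/eqP; rewrite -subr_eq0 -coinv_piB; apply/eqP/coinv_pi_eq0 => m sm.
set g := comb _ _ _; rewrite mcoeffB.
have [mE|mE] := eqVneq (multideg m) E; last first.
  rewrite !memN_msupp_eq0 ?subrr //; apply: contra mE => mE; apply/eqP; last exact: fE.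
  exact: (multihomog_comb mE).
case: (standardP sm) mE => [A _|j A _]; rewrite ?multideg_zmnm ?multideg_yzmnm => mE.
  by rewrite mE mcoeff_comb_z subrr.
have Ej : E j != 0%N by rewrite -mE mnmDE mnm1E eqxx addn1.
have -> : A = (E - U_(j))%MM by rewrite -mE addmK.
by rewrite mcoeff_comb_y // subrr.
Qed.

(** A coefficient is determined only when its monomial is standard, hence the separate conditions on
    E and on E lowered at j. *)
Lemma comb_eq0 (E : 'X_{1..l}) c d : coinv_pi (comb E c d) = 0 ->
  ([forall i, (E i < p)%N] -> c = 0) /\
  (forall j, E j != 0%N -> [forall i, ((E - U_(j))%MM i < p)%N] -> d j = 0).
Proof.
move/coinv_pi_eq0 => c0; split=> [Ep|j Ej Ep].
  by rewrite -(mcoeff_comb_z E c d) c0 // standard_zmnm.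
by rewrite -(mcoeff_comb_y c d Ej) c0 // standard_yzmnm.
Qed.

Lemma zmon_eq0 (E : 'X_{1..l}) : ~~ [forall i, (E i < p)%N] -> zmon F E = 0.
Proof.
by move=> Ep; rewrite -coinv_zmnm coinv_nonstandard // standard_zmnm.
Qed.

Lemma component_nonzeroP (E : 'X_{1..l}) : component_nonzero F E <->
  [forall i, (E i < p)%N] \/
  exists2 j, E j != 0%N & [forall i, ((E - U_(j))%MM i < p)%N].
Proof.
split=> [[x /componentP [c [d ->]]]|].
  rewrite coinv_comb => nz.
  have [Ep|Ep] := boolP [forall i, (E i < p)%N]; [by left|right].
  move: nz; rewrite zmon_eq0 // scaler0 add0r => nz.
  have /existsP [j /andP [Ej Ejp]] :
      [exists j, (E j != 0%N) && [forall i, ((E - U_(j))%MM i < p)%N]]; last by exists j.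
  apply: contraR nz; rewrite negb_exists => /forallP h.
  rewrite big1 // => j Ej; rewrite zmon_eq0 ?mulr0 ?scaler0 //.
  by move: (h j); rewrite Ej.
have ex c d : coinv_pi (comb E c d) != 0 -> component_nonzero F E.
  by move=> nz; exists (coinv_pi (comb E c d)) => //; apply/componentP; exists c, d.
(* All coefficients are set to 1, so that whichever monomial is standard contributes a nonzero
   term. *)
case=> [Ep|[j Ej Ep]]; apply: (ex 1 (fun=> 1)); apply/eqP => /comb_eq0 [c0 d0].
  by move/eqP: (c0 Ep); rewrite oner_eq0.
by move/eqP: (d0 j Ej Ep); rewrite oner_eq0.
Qed.

(** * The action of [sigma] on the coinvariants *)

Lemma coinv_sigmaM (x y : coinvariants F l) :
  coinv_sigma (x * y) = coinv_sigma x * coinv_sigma y.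
Proof.
rewrite -(coinv_piK x) -(coinv_piK y) -coinv_piM !coinv_sigma_pi.
by rewrite sigmaM coinv_piM.
Qed.

Lemma coinv_sigmaD (x y : coinvariants F l) :
  coinv_sigma (x + y) = coinv_sigma x + coinv_sigma y.
Proof.
rewrite -(coinv_piK x) -(coinv_piK y) -coinv_piD !coinv_sigma_pi.
by rewrite sigmaD coinv_piD.
Qed.

Lemma coinv_sigmaZ c (x : coinvariants F l) :
  coinv_sigma (c *: x) = c *: coinv_sigma x.
Proof.
rewrite -(coinv_piK x) -coinv_piZ !coinv_sigma_pi -mul_mpolyC sigmaM sigmaC.
by rewrite mul_mpolyC coinv_piZ.
Qed.

Lemma coinv_sigma_cy (j : 'I_l) : coinv_sigma (cy F j) = cy F j.
Proof. by rewrite coinv_sigma_pi sigmaY coinv_piD coinv_X addr0. Qed.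

Lemma coinv_sigma_cz (i : 'I_l) : coinv_sigma (cz F i) = cz F i + cy F i.
Proof. by rewrite coinv_sigma_pi sigmaZ coinv_piD. Qed.

(** Expanding the product of the (z_i + y_i)^(e_i) stops at first order because products of two y
    vanish. The induction on total degree removes one z_i at a time. *)
Lemma coinv_sigma_zmon (E : 'X_{1..l}) : coinv_sigma (zmon F E) =
  zmon F E + \sum_j (E j)%:R *: (cy F j * zmon F (E - U_(j))%MM).
Proof.
under eq_bigr do rewrite scaler_nat.
elim: {E}(mdeg E) {-2}E (erefl (mdeg E)) => [|n IH] E.
  move/eqP; rewrite mdeg_eq0 => /eqP ->.
  rewrite big1 => [|j _]; last by rewrite mnm0E mulr0n.
  by rewrite -coinv_zmnm addr0 coinv_zmnm /zmon big1 => [|i _];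
    rewrite ?mnm0E ?expr0 // -(rmorph1 (@coinv_pi F l)) coinv_sigma_pi /= [sigma 1]rmorph1.
move=> En; have [i Ei] : exists i, E i != 0%N.
  apply/existsP; apply: contra_eqT En; rewrite negb_exists => /forallP E0.
  by rewrite mdegE big1 // => i _; apply/eqP; rewrite -[_ == _]negbK E0.
have EE : E = (E - U_(i) + U_(i))%MM by rewrite submK // lep1mP.
set B := (E - U_(i))%MM in EE; rewrite EE in En *.
have {}En : mdeg B = n by move: En; rewrite mdegD mdeg1 addn1 => -[].
rewrite zmonD zmonU coinv_sigmaM coinv_sigma_cz (IH _ En) mulrDl mulrDr -addrA.
congr (_ + _); rewrite mulrDr addrCA.
rewrite [X in _ + (_ + X)]mulr_suml [X in _ + (_ + X)]big1 => [|j _]; last first.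
  by rewrite mulrnAl mulrAC cyM mul0r mul0rn.
under [RHS]eq_bigr do rewrite mnmDE mulrnDr.
rewrite big_split /= addr0 mulr_suml; congr (_ + _).
  (* If [B j] is 0 the truncated [B - U_(j)] is meaningless as a quotient, but its coefficient is
     0. *)
  apply: eq_bigr => j _; have [->|Bj] := eqVneq (B j) 0%N; first by rewrite !mulr0n mul0r.
  rewrite mulrnAl -mulrA -zmonU -zmonD; congr (_ * zmon F _ *+ _).
  by rewrite addmC addmBA ?lep1mP // addmC.
rewrite (bigD1 i) //= big1 => [|j ij].
  by rewrite addmK mnm1E eqxx mulr1n addr0 mulrC.
by rewrite mnm1E eq_sym (negPf ij) mulr0n.
Qed.

Lemma coinv_sigma_yzmon j (A : 'X_{1..l}) :
  coinv_sigma (cy F j * zmon F A) = cy F j * zmon F A.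
Proof.
rewrite coinv_sigmaM coinv_sigma_cy coinv_sigma_zmon mulrDr mulr_sumr big1 ?addr0 // => i _.
by rewrite scaler_nat mulrnAr mulrA cyM mul0r mul0rn.
Qed.

Lemma coinv_sigma_comb (E : 'X_{1..l}) c d :
  coinv_sigma (coinv_pi (comb E c d)) =
  coinv_pi (comb E c (fun j => d j + c * (E j)%:R)).
Proof.
have sum (I : finType) (P : pred I) (G : I -> coinvariants F l) :
    coinv_sigma (\sum_(i | P i) G i) = \sum_(i | P i) coinv_sigma (G i).
  apply: (big_morph _ coinv_sigmaD).
  by have := coinv_sigmaZ 0 0; rewrite !scale0r.
rewrite !coinv_comb coinv_sigmaD coinv_sigmaZ sum coinv_sigma_zmon scalerDr -addrA.
congr (_ + _); rewrite [in RHS](eq_bigr _ (fun j _ => scalerDl _ _ _)) big_split addrC /=.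
congr (_ + _).
  by apply: eq_bigr => j _; rewrite coinv_sigmaZ coinv_sigma_yzmon.
(* Indices with e_j = 0 carry the coefficient 0, so the sum over all j restricts to the index set of
   [comb]. *)
rewrite scaler_sumr (bigID (fun j => E j != 0%N)) /= [X in _ + X]big1 ?addr0 => [|j].
  by apply: eq_bigr => j _; rewrite scalerA.
by rewrite negbK => /eqP ->; rewrite scale0r scaler0.
Qed.

(** * Linear combinations and spanning sets of the components *)

Lemma coinv_comb_linear (E : 'X_{1..l}) a c d c' d' :
  coinv_pi (comb E (a * c + c') (fun j => a * d j + d' j)) =
  a *: coinv_pi (comb E c d) + coinv_pi (comb E c' d').
Proof.
rewrite !coinv_comb scalerDr addrACA scalerA -scalerDl; congr (_ + _).
rewrite scaler_sumr -big_split; apply: eq_bigr => j _ /=.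
by rewrite scalerDl scalerA.
Qed.

Lemma eq_comb (E : 'X_{1..l}) c d c' d' : c = c' -> d =1 d' ->
  comb E c d = comb E c' d' :> FV3.
Proof. by move=> -> dd; congr (_ + _); apply: eq_bigr => j _; rewrite dd. Qed.

Lemma coinv_combZ (E : 'X_{1..l}) a c d :
  a *: coinv_pi (comb E c d) = coinv_pi (comb E (a * c) (fun j => a * d j)) :> coinvariants F l.
Proof.
have := coinv_comb_linear E a c d 0 (fun=> 0).
have -> : coinv_pi (comb E 0 (fun=> 0)) = 0 :> coinvariants F l.
  by rewrite coinv_comb scale0r add0r big1 // => j _; rewrite scale0r.
by rewrite [RHS]addr0 => <-; congr coinv_pi; apply: eq_comb => [|j]; rewrite addr0.
Qed.

Lemma in_span_cons (W : lmodType F) (s : seq W) (v : W) a x :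
  in_span s x -> in_span (v :: s) (a *: v + x).
Proof.
case=> c ->; exists (fun i : 'I_(size s).+1 => if unlift ord0 i is Some j then c j else a).
rewrite big_ord_recl unlift_none; congr (_ + _).
by apply: eq_bigr => i _; rewrite liftK.
Qed.

Lemma in_span_map (I : Type) (W : lmodType F) (r : seq I) (G : I -> W) (d : I -> F) :
  in_span (map G r) (\sum_(j <- r) d j *: G j).
Proof.
elim: r => [|j r IH]; last by rewrite big_cons; apply: in_span_cons.
by exists (fun=> 0); rewrite big_nil big_ord0.
Qed.

Lemma component_span (E : 'X_{1..l}) (x : coinvariants F l) :
  component E x <-> in_span (component_gens F E) x.
Proof.
split=> [/componentP [c [d ->]]|[c ->]].
  rewrite coinv_comb; apply: in_span_cons.
  rewrite [X in in_span _ X](_ : _ =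
    \sum_(j <- [seq j <- enum 'I_l | E j != 0%N]) d j *: (cy F j * zmon F (E - U_(j))%MM)).
    exact: in_span_map.
  by rewrite big_filter big_enum_cond.
have comp0 : component E (0 : coinvariants F l).
  by exists 0 => [m|]; rewrite ?msupp0 ?coinv_pi0.
apply: big_ind => [//|_ _ /componentP [a [b ->]] /componentP [a' [b' ->]]|i _].
  apply/componentP; exists (1 * a + a'), (fun j => 1 * b j + b' j).
  by rewrite coinv_comb_linear scale1r.
suff /componentP [a [b ->]] : component E (component_gens F E)`_i.
  by apply/componentP; rewrite coinv_combZ; do 2 eexists.
have : (component_gens F E)`_i \in component_gens F E by rewrite mem_nth.
rewrite inE => /orP [/eqP ->|/mapP [j]].
  apply/componentP; exists 1, (fun=> 0); rewrite coinv_comb scale1r big1 ?addr0 // => k _.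
  by rewrite scale0r.
rewrite mem_filter => /andP [Ej _] ->; apply/componentP; exists 0, (fun k => (k == j)%:R).
rewrite coinv_comb scale0r add0r (bigD1 j) //= eqxx scale1r big1 ?addr0 // => k.
by case/andP=> _ /negPf ->; rewrite scale0r.
Qed.

(** * Components as representations *)

Lemma jordan1_2E (v : 'rV[F]_2) :
  (v *m jordan1 F 2) 0 0 = v 0 0 /\ (v *m jordan1 F 2) 0 1 = v 0 1 + v 0 0.
Proof.
have lift01 : lift ord0 ord0 = 1 :> 'I_2 by apply: val_inj.
split; rewrite mxE big_ord_recl big_ord1 lift01 !mxE /=.
  by rewrite !addr0 mulr1 mulr0 addr0.
by rewrite addr0 add0r !mulr1 addrC.
Qed.

Lemma jordan1_1E : jordan1 F 1 = 1%:M.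
Proof. by apply/matrixP => i j; rewrite !ord1 !mxE addr0. Qed.

(** Used to index the k-1 copies of V_1 by the nonzero positions of E other than a chosen one. *)
Lemma enum_setD1 (S : {set 'I_l}) j0 : j0 \in S -> exists t : 'I_#|S|.-1 -> 'I_l,
  [/\ injective t, forall i, t i \in S :\ j0 & forall j, j \in S :\ j0 -> exists i, t i = j].
Proof.
move=> j0S; have e : #|S|.-1 = #|S :\ j0| by rewrite (cardsD1 j0 S) j0S.
exists (fun i => enum_val (cast_ord e i)); split=> [i j /enum_val_inj /cast_ord_inj //|i|j jS].
  exact: enum_valP.
exists (cast_ord (esym e) (enum_rank_in jS j)).
by rewrite cast_ordKV enum_rankK_in.
Qed.

(** V_2 is spanned by z^E and w, the sum of the e_j y_j z^E / z_j; the copies of V_1 by the y_j z^E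
    / z_j with j different from j0. These form a basis because e_j0 is nonzero in F, so w can
    replace the missing y_j0 z^E / z_j0. *)
Lemma component_iso_V2V1 (E : 'X_{1..l}) :
  (0 < mdeg E)%N -> [forall i, (E i < p)%N] ->
  iso_to_sub (@V2_plus_V1s_act F (nb_nonzero E).-1)
             (@coinv_sigma F l) (component E).
Proof.
move=> E_gt0 /[dup] Ep /forallP Elt.
have EUp j : [forall i, ((E - U_(j))%MM i < p)%N].
  by apply/forallP => i; rewrite mnmBE (leq_ltn_trans (leq_subr _ _)).
have Ene0 j : E j != 0%N -> (E j)%:R != 0 :> F.
  by move=> Ej; rewrite -(dvdn_pcharf p_char) gtnNdvd ?lt0n ?Elt.
have [j0 Ej0] : exists j, E j != 0%N.
  apply/existsP; apply: contraTT E_gt0; rewrite negb_exists => /forallP E0.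
  by rewrite -eqn0Ngt mdegE big1 // => i _; apply/eqP; rewrite -[_ == _]negbK E0.
have j0S : j0 \in [set i : 'I_l | E i != 0%N] by rewrite inE.
have [t [t_inj tS St]] := enum_setD1 j0S; rewrite -/(nb_nonzero E) in t t_inj tS St.
have Et i : E (t i) != 0%N by have := tS i; rewrite !inE => /andP [].
set U := V2_plus_V1s F _.
(* The first term is the contribution of w. The sum has at most one term, the V_1 coordinate
   attached to j, and is empty at j0. *)
pose d (u : U) j : F := (u.1 : 'rV[F]_2) 0 1 * (E j)%:R
  + \sum_(i | t i == j) (u.2 i : 'rV[F]_1) 0 0.
pose f (u : U) := coinv_pi (comb E ((u.1 : 'rV[F]_2) 0 0) (d u)).
have f_linear : linear f.
  move=> a u v; rewrite /f -coinv_comb_linear; congr coinv_pi; apply: eq_comb => [|j].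
    by rewrite !mxE.
  rewrite /d !mxE mulrDl mulrDr addrACA mulrA mulr_sumr -big_split /=.
  by congr (_ + _); apply: eq_bigr => i _; rewrite !ffunE !mxE.
have d_t (u : U) i : d u (t i) = (u.1 : 'rV[F]_2) 0 1 * (E (t i))%:R + (u.2 i : 'rV[F]_1) 0 0.
  rewrite /d (big_pred1 i) // => k; exact: inj_eq.
have d_j0 (u : U) : d u j0 = (u.1 : 'rV[F]_2) 0 1 * (E j0)%:R.
  rewrite /d big1 ?addr0 // => i /eqP ti.
  by have := tS i; rewrite ti !inE eqxx.
pose fL : {linear U -> coinvariants F l} :=
  HB.pack f (GRing.isLinear.Build F U (coinvariants F l) *:%R f f_linear).
exists fL; split.
- apply: raddf_inj => u /comb_eq0 [/(_ Ep) c0 d0].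
  have u1 : (u.1 : 'rV[F]_2) 0 1 = 0.
    by apply/eqP; move/eqP: (d0 j0 Ej0 (EUp j0)); rewrite d_j0 mulf_eq0 (negPf (Ene0 _ Ej0)) orbF.
  case: u c0 d0 u1 => u v /= c0 d0 u1; congr (_, _).
    apply/rowP => -[[|[|//]] i]; rewrite mxE.
      by rewrite -[RHS]c0; congr (u _ _); apply: val_inj.
    by rewrite -[RHS]u1; congr (u _ _); apply: val_inj.
  apply/ffunP => i; apply/rowP => k; rewrite ord1 !ffunE mxE.
  by have := d0 (t i) (Et i) (EUp _); rewrite d_t /= u1 mul0r add0r.
- move=> x; split=> [/componentP [c [e ->]]|[u <-]]; last first.
    by apply/componentP; exists ((u.1 : 'rV[F]_2) 0 0), (d u).
  (* No V_1 contributes at j0, so that coefficient determines the multiple of w; the V_1 coordinates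
     are the remainders. *)
  pose b := e j0 / (E j0)%:R.
  pose u : U := (\row_(i < 2) (if i == 0 then c else b),
    [ffun i => \row_(k < 1) (e (t i) - b * (E (t i))%:R)]).
  have u1 : (u.1 : 'rV[F]_2) 0 1 = b by rewrite mxE.
  exists u; rewrite /= /f !coinv_comb; congr (_ + _); first by rewrite mxE.
  apply: eq_bigr => j Ej; congr (_ *: _).
  have [->|jj0] := eqVneq j j0; first by rewrite d_j0 u1 divfK ?Ene0.
  have [|i <-] := St j; first by rewrite !inE jj0.
  by rewrite d_t u1 ffunE mxE addrC subrK.
- move=> u; rewrite /= /f coinv_sigma_comb; have [e0 e1] := jordan1_2E u.1.
  congr coinv_pi; apply: eq_comb => [|j]; first exact: e0.
  rewrite /d /= /Vact e1 mulrDl addrAC; congr (_ + _ + _).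
  by apply: eq_bigr => i _; rewrite ffunE jordan1_1E mulmx1.
Qed.

(** Some exponent e_j equals p and the others are below p. Then z^E and the y_i z^E / z_i with i
    different from j contain z_j^p = 0, leaving a line fixed by [sigma]. *)
Lemma component_iso_V1 (E : 'X_{1..l}) :
  component_nonzero F E -> ~~ [forall i, (E i < p)%N] ->
  iso_to_sub (@Vact F 1) (@coinv_sigma F l) (component E).
Proof.
move=> /component_nonzeroP [->//|[j Ej EUp]] /[dup] Ep.
rewrite negb_forall => /existsP [i]; rewrite -leqNgt => Ei.
(* Lowering at j brings every exponent below p, so an exponent that is at least p can only sit at
   j. *)
have ij : i = j.
  apply/eqP; apply: contraTT Ei => ij; rewrite -ltnNge.
  by have := forallP EUp i; rewrite mnmBE mnm1E eq_sym (negPf ij) subn0.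
rewrite {}ij in Ei => {i}.
have y0 i : i != j -> zmon F (E - U_(i))%MM = 0.
  move=> ij; apply: zmon_eq0; rewrite negb_forall; apply/existsP; exists j.
  by rewrite mnmBE mnm1E (negPf ij) subn0 -leqNgt.
have combE c d : coinv_pi (comb E c d) = d j *: (cy F j * zmon F (E - U_(j))%MM).
  rewrite coinv_comb zmon_eq0 // scaler0 add0r (bigD1 j) //= big1 ?addr0 // => i.
  by case/andP=> _ ij; rewrite y0 // mulr0 scaler0.
pose f (u : Vrep F 1) := (u : 'rV[F]_1) 0 0 *: (cy F j * zmon F (E - U_(j))%MM).
have f_linear : linear f by move=> a u v; rewrite /f !mxE scalerDl scalerA.
pose fL : {linear Vrep F 1 -> coinvariants F l} :=
  HB.pack f (GRing.isLinear.Build F (Vrep F 1) (coinvariants F l) *:%R f f_linear).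
exists fL; split.
- apply: raddf_inj => u /= fu.
  have [_ /(_ j Ej EUp) u0] : _ := comb_eq0 (etrans (combE 0 (fun=> (u : 'rV[F]_1) 0 0)) fu).
  by apply/rowP => i; rewrite ord1 mxE.
- move=> x; split=> [/componentP [c [d ->]]|[u <-]].
    by exists (const_mx (d j) : 'rV[F]_1); rewrite combE /= /f mxE.
  by apply/componentP; exists 0, (fun=> (u : 'rV[F]_1) 0 0); rewrite combE.
- move=> u; rewrite /= /f coinv_sigmaZ coinv_sigma_yzmon.
  by rewrite /Vact jordan1_1E mulmx1.
Qed.

(** * Bounds on the total degree, and the top degree *)

Lemma mdeg_leqif (E : 'X_{1..l}) : [forall i, (E i < p)%N] ->
  (mdeg E <= l * p.-1 ?= iff (E == const_multideg l p.-1))%N.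
Proof.
move=> /forallP Ep; have := @leqif_sum _ predT (fun i => E i == p.-1) E (fun=> p.-1).
rewrite -mdegE sum_nat_const card_ord => h.
have -> : (E == const_multideg l p.-1) = [forall (i | predT i), E i == p.-1].
  apply/eqP/forallP => [-> i|h']; first by rewrite mnmE /=.
  by apply/mnmP => i; rewrite mnmE; apply/eqP/(h' i).
by apply: h => i _; split; rewrite // -ltnS (ltn_predK (Ep i)).
Qed.

End HilbertIdeal.

Theorem theorem3p10 (F : fieldType) (p l : nat)
    (p_char : p \in [pchar F]) (p_gt2 : (2 < p)%N) (l_gt0 : (0 < l)%N) :
  [/\ (* the top degree is l(p-1)+1 *)
      forall E : 'X_{1..l}, ((l * p.-1).+1 < mdeg E)%N ->
        ~ @component_nonzero F l E,
      (* the non-zero components in top degree *)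
      forall E : 'X_{1..l}, mdeg E = (l * p.-1).+1 ->
        (@component_nonzero F l E <->
         exists j : 'I_l, E = (const_multideg l p.-1 + U_(j))%MM),
      forall j : 'I_l,
        let g : coinvariants F l := cy F j * zmon F (const_multideg l p.-1) in
        g != 0 /\
        forall x : coinvariants F l,
          component (const_multideg l p.-1 + U_(j))%MM x <-> exists c : F, x = c *: g &
      (* the degrees strictly between 0 and l(p-1)+1 *)
      forall E : 'X_{1..l}, (0 < mdeg E < (l * p.-1).+1)%N ->
        @component_nonzero F l E ->
        (forall x : coinvariants F l,
           component E x <-> in_span (component_gens F E) x) /\
        (if [forall i, (E i < p)%N] then
           iso_to_sub (@V2_plus_V1s_act F (nb_nonzero E).-1)
                      (@coinv_sigma F l) (component E)
         else (* e_j = p for some j: then z^E = 0 and only y_j z^E / z_j survives *)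
           iso_to_sub (@Vact F 1) (@coinv_sigma F l) (component E))].
Proof.
have p_gt0 : (0 < p)%N by apply: leq_trans p_gt2.
have topU j : mdeg (const_multideg l p.-1 + U_(j)) = (l * p.-1).+1.
  rewrite mdegD mdeg1 addn1 mdegE; congr _.+1.
  by under eq_bigr do rewrite mnmE; rewrite sum_nat_const card_ord.
have constp : [forall i, (const_multideg l p.-1 i < p)%N].
  by apply/forallP => i; rewrite mnmE prednK.
split=> [E Edeg /(component_nonzeroP p_char p_gt2) nz|E Edeg|j g|E /andP [E_gt0 _] nz].
(* A nonzero z^E has degree at most l(p-1), and a nonzero y_j z^E / z_j at most one more. *)
- case: nz => [/mdeg_leqif [le _]|[j Ej /mdeg_leqif [le _]]].
    by move: Edeg; rewrite ltnNge (leq_trans le).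
  move: Edeg; rewrite -(submK (_ : (U_(j) <= E)%MM)) ?lep1mP // mdegD mdeg1 addn1.
  by rewrite ltnS ltnNge le.
- rewrite (component_nonzeroP p_char p_gt2).
  (* In degree l(p-1)+1 the monomial z^E is too large to survive, and E lowered at j attains the
     bound, which forces all its entries to be p-1. *)
  split=> [[/mdeg_leqif [le _]|[j Ej /mdeg_leqif [_ iff]]]|[j ->]].
  + by move: le; rewrite Edeg ltnn.
  + have EE : E = (E - U_(j) + U_(j))%MM by rewrite submK // lep1mP.
    exists j; rewrite {1}EE; congr (_ + _)%MM; apply/eqP; rewrite -iff.
    by move: Edeg; rewrite {1}EE mdegD mdeg1 addn1 => -[->].
  + right; exists j; last by rewrite addmK.
    by rewrite mnmDE mnm1E eqxx addn1.
- pose E := (const_multideg l p.-1 + U_(j))%MM.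
  have Ej : E j != 0%N by rewrite mnmDE mnm1E eqxx addn1.
  have EE : (E - U_(j))%MM = const_multideg l p.-1 by rewrite addmK.
  have Enz : ~~ [forall i, (E i < p)%N].
    by apply/negP => /mdeg_leqif [+ _]; rewrite topU ltnn.
  (* Here e_j = p, so z^E and every y_i z^E / z_i with i different from j still contain z_j^p =
     0. *)
  have combE c d : coinv_pi (comb E c d) = d j *: g.
    rewrite coinv_comb (zmon_eq0 p_char p_gt2) // scaler0 add0r (bigD1 j) //= EE.
    rewrite big1 ?addr0 // => i /andP [_ ij].
    rewrite (zmon_eq0 p_char p_gt2) ?mulr0 ?scaler0 // negb_forall; apply/existsP.
    exists j; rewrite mnmBE mnmDE mnmE !mnm1E eqxx (negPf ij) subn0 addn1 prednK //.
    by rewrite -leqNgt.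
  split=> [|x].
    apply/eqP => g0; have := combE 0 (fun=> 1); rewrite g0 scaler0.
    case/(comb_eq0 p_char p_gt2) => _ /(_ j Ej); rewrite EE => /(_ constp) /eqP.
    by rewrite oner_eq0.
  rewrite (componentP p_char p_gt2) -/E.
  split=> [[c [d ->]]|[c ->]]; first by exists (d j); rewrite combE.
  by exists 0, (fun=> c); rewrite combE.
- split=> [x|]; first exact: component_span p_char p_gt2 _ _.
  have [Ep|Ep] := boolP [forall i, (E i < p)%N]; first exact: (component_iso_V2V1 p_char p_gt2).
  exact: (component_iso_V1 p_char p_gt2).
Qed.
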